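(* Let $A$ be a set of positive integers. For every integer $n>0$, (1) $\displaystyle e_2p_A(n)=\frac12\left(n^2\,p(n|A)-\sum_{k=1}^n\sigma_{2,A}(k)\,p(n-k|A)\right)$; (2) $\displaystyle e_3p_A(n)=\frac16\left(n^3\,p(n|A)-\sum_{k=1}^n\big(3\,n\,\sigma_{2,A}(k)-2\,\sigma_{3,A}(k)\big)\,p(n-k|A)\right)$.
   Context: A partition $\lambda=(\lambda_1,\dots,\lambda_\ell)$ of $n$ is a weakly decreasing sequence of positive integers (its parts) with sum $n$; $\ell(\lambda)=\ell$ is its length; the empty partition is the only partition of $0$. For a partition $\lambda$, $e_j(\lambda)=\sum_{1\le i_1<\cdots<i_j\le \ell(\lambda)}\lambda_{i_1}\cdots\lambda_{i_j}$ is the $j$-th elementary symmetric polynomial evaluated at the parts of $\lambda$, with $e_j(\lambda)=0$ if $\ell(\lambda)<j$. For a set $A$ of positive integers, $\mathcal P(n|A)$ is the set of partitions of $n$ all of whose parts lie in $A$, $p(n|A)=|\mathcal P(n|A)|$ (so $p(0|A)=1$), $e_jp_A(n)=\sum_{\lambda\in\mathcal P(n|A)}e_j(\lambda)$, and $\sigma_{j,A}(n)=\sum_{d\mid n,\ d\in A}d^j$. *)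

(* Defs.v *)
From HB Require Import structures.
From mathcomp Require Import all_boot all_order all_algebra.
From mathcomp Require Import all_classical.

Set Implicit Arguments.
Unset Strict Implicit.
Unset Printing Implicit Defensive.

Definition is_intpart (n : nat) (l : seq nat) : bool :=
  [&& sorted geq l, all (leq 1) l & sumn l == n].

Record intpart (n : nat) : Type := IntPart {
  parts :> seq nat;
  partsP : is_intpart n parts
}.

HB.instance Definition _ n := [isSub for @parts n].
HB.instance Definition _ n := [Countable of intpart n by <:].

Lemma leq_part_sumn (l : seq nat) (x : nat) : x \in l -> x <= sumn l.
Proof.
elim: l => //= y l IHl; rewrite in_cons => /orP[/eqP->|/IHl le_x].
  exact: leq_addr.
exact: leq_trans le_x (leq_addl _ _).
Qed.

Lemma leq_size_sumn (l : seq nat) : all (leq 1) l -> size l <= sumn l.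
Proof.
by elim: l => //= y l IHl /andP[y_gt0 /IHl le_l]; rewrite -add1n leq_add.
Qed.

(* A partition of n has at most n parts, each at most n, so the next two      *)
(* functions embed intpart n in a finite type.                                *)
Definition intpart_code n (l : intpart n) : n.-bseq 'I_n.+1 :=
  insub_bseq n (map inord l).

Definition intpart_decode n (b : n.-bseq 'I_n.+1) : option (intpart n) :=
  insub (map val b).

Lemma intpart_codeK n : pcancel (@intpart_code n) (@intpart_decode n).
Proof.
move=> l; have /and3P[_ l_gt0 /eqP sum_l] := partsP l.
have le_l : size (map (inord : nat -> 'I_n.+1) l) <= n.
  by rewrite size_map -{2}sum_l leq_size_sumn.
have code_l : intpart_code l = map inord l :> seq 'I_n.+1.
  by rewrite /intpart_code /insub_bseq val_insubd le_l.
rewrite /intpart_decode code_l -map_comp (_ : map _ _ = l) ?valK //.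
rewrite -[RHS]map_id; apply/eq_in_map => x x_in /=.
by rewrite inordK // ltnS -sum_l leq_part_sumn.
Qed.

HB.instance Definition _ n : isFinite (intpart n) :=
  PCanIsFinite (@intpart_codeK n).

Definition partitions_in (A : set nat) (n : nat) : {set intpart n} :=
  [set l : intpart n | all (fun x => x \in A) l].

Definition npart (A : set nat) (n : nat) : nat := #|partitions_in A n|.

(* Strictly increasing tuples i_1 < ... < i_j of positions are identified     *)
(* with j-element sets I of positions, so equal parts are not merged.         *)
Definition elem_sym (j : nat) (l : seq nat) : nat :=
  \sum_(I : {set 'I_(size l)} | #|I| == j) \prod_(i in I) nth 0 l i.

Definition elem_sym_part (j : nat) (A : set nat) (n : nat) : nat :=
  \sum_(l in partitions_in A n) elem_sym j l.

Definition sigma (j : nat) (A : set nat) (n : nat) : nat :=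
  \sum_(d <- divisors n | d \in A) d ^ j.

(* Main.v *)
(* Sum Newton's identities e_2 = (p_1^2 - p_2)/2 and
   e_3 = (p_1^3 - 3 p_1 p_2 + 2 p_3)/6 over the partitions of n, for which
   p_1 = n.  The total of p_j is obtained by counting each part d of a partition
   once for every i with 1 <= i <= mult(d); deleting i copies of d shows that
   p(n - i d | A) partitions contain d at least i times, and grouping the pairs
   (i, d) by k = i d yields the convolution of sigma_{j,A} with p(. | A). *)
Require Import Defs.
From HB Require Import structures.
From mathcomp Require Import all_boot all_order all_algebra.
From mathcomp Require Import all_classical.
From mathcomp Require Import ring.

Set Implicit Arguments.
Unset Strict Implicit.
Unset Printing Implicit Defensive.

Import Order.TTheory GRing.Theory Num.Theory.
Local Open Scope ring_scope.

(** Expanding the product means choosing [x%:R *: 'X] or [1] in each factor; the set [I] of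
    positions with the first choice contributes a monomial of degree [#|I|]. Peeling off one factor
    then gives a recursion on the list, which the sum over sets of positions hides. *)
Lemma elem_sym_coef (j : nat) (l : seq nat) :
  (elem_sym j l)%:R = (\prod_(x <- l) (x%:R *: 'X + 1) : {poly rat})`_j.
Proof.
rewrite (big_nth 0%N) big_mkord bigA_distr coef_sum /elem_sym natr_sum.
rewrite big_mkcond; apply: eq_bigr => I _ /=.
have -> : \prod_i (if i \in I then (nth 0%N l i)%:R *: 'X else 1 : {poly rat})
          = (\prod_(i in I) nth 0%N l i)%:R *: 'X^#|I|.
  by rewrite -big_mkcond scaler_prod prodr_const natr_prod.
rewrite coefZ coefXn eq_sym.
by case: eqP => _; rewrite ?mulr1 ?mulr0.
Qed.

Lemma elem_sym_cons (j x : nat) (l : seq nat) :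
  (elem_sym j.+1 (x :: l))%:R
    = x%:R * (elem_sym j l)%:R + (elem_sym j.+1 l)%:R :> rat.
Proof.
by rewrite !elem_sym_coef big_cons mulrDl mul1r coefD -scalerAl coefZ coefXM.
Qed.

Lemma elem_sym0 (l : seq nat) : (elem_sym 0 l)%:R = 1 :> rat.
Proof.
rewrite elem_sym_coef; elim: l => [|x l IHl]; first by rewrite big_nil coef1.
by rewrite big_cons mulrDl mul1r coefD -scalerAl coefZ coefXM IHl mulr0 add0r.
Qed.

Lemma elem_symS_nil (j : nat) : (elem_sym j.+1 [::])%:R = 0 :> rat.
Proof. by rewrite elem_sym_coef big_nil coef1. Qed.

Definition power_sum (j : nat) (l : seq nat) : nat := \sum_(x <- l) x ^ j.

Lemma power_sum_cons (j x : nat) (l : seq nat) :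
  power_sum j (x :: l) = (x ^ j + power_sum j l)%N.
Proof. by rewrite /power_sum big_cons. Qed.

Lemma elem_sym1 (l : seq nat) : (elem_sym 1 l)%:R = (sumn l)%:R :> rat.
Proof.
elim: l => [|x l IHl]; first by rewrite elem_symS_nil.
by rewrite elem_sym_cons elem_sym0 mulr1 IHl natrD.
Qed.

(** The recursion of [elem_sym_cons] turns the inductive step into a polynomial identity in [x], the
    sum and the power sum of the tail. *)
Lemma elem_sym2 (l : seq nat) :
  (elem_sym 2 l)%:R
    = 1 / 2%:R * ((sumn l)%:R ^+ 2 - (power_sum 2 l)%:R) :> rat.
Proof.
elim: l => [|x l IHl].
  by rewrite elem_symS_nil /power_sum big_nil expr0n subrr mulr0.
rewrite elem_sym_cons elem_sym1 IHl power_sum_cons /= !natrD natrX.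
by field.
Qed.

Lemma elem_sym3 (l : seq nat) :
  (elem_sym 3 l)%:R
    = 1 / 6%:R * ((sumn l)%:R ^+ 3 - 3%:R * (sumn l)%:R * (power_sum 2 l)%:R
                  + 2%:R * (power_sum 3 l)%:R) :> rat.
Proof.
elim: l => [|x l IHl].
  by rewrite elem_symS_nil /power_sum !big_nil /=; field.
rewrite elem_sym_cons elem_sym2 IHl !power_sum_cons /= !natrD !natrX.
by field.
Qed.

(** * Inserting and deleting a part *)

Local Open Scope nat_scope.

Lemma intpart_insert_subproof (d n : nat) (d_gt0 : 0 < d) (l : intpart n) :
  is_intpart (d + n) (sort geq (d :: l)).
Proof.
have /and3P[_ l_gt0 /eqP sum_l] := partsP l.
have geq_total : total geq by move=> x y; exact: leq_total.
by rewrite /is_intpart sort_sorted // all_sort (perm_sumn (permEl (perm_sort _ _)))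
           /= d_gt0 l_gt0 sum_l eqxx.
Qed.

Definition intpart_insert (d n : nat) (d_gt0 : 0 < d) (l : intpart n) :
  intpart (d + n) := IntPart (intpart_insert_subproof d_gt0 l).

(** A multiset has only one decreasing arrangement, so the sorting done by [intpart_insert] can be
    ignored when comparing partitions. *)
Lemma intpart_perm_inj (n : nat) (l1 l2 : intpart n) :
  perm_eq l1 l2 -> l1 = l2.
Proof.
have /and3P[s1 _ _] := partsP l1; have /and3P[s2 _ _] := partsP l2.
move=> eq_l; apply/val_inj; apply: (sorted_eq _ _ s1 s2 eq_l).
  by move=> x y z /= xy yz; exact: leq_trans yz xy.
by move=> x y /andP[xy yx]; apply/eqP; rewrite eqn_leq; apply/andP.
Qed.

Lemma intpart_insertP (d n : nat) (d_gt0 : 0 < d) (l : intpart n) :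
  perm_eq (intpart_insert d_gt0 l) (d :: l).
Proof. exact: permEl (perm_sort _ _). Qed.

Lemma intpart_insert_inj (d n : nat) (d_gt0 : 0 < d) :
  injective (@intpart_insert d n d_gt0).
Proof.
move=> l1 l2 eq_l; apply: intpart_perm_inj; rewrite -(perm_cons d).
rewrite -(permPr (intpart_insertP d_gt0 l2)) -eq_l perm_sym.
exact: intpart_insertP.
Qed.

Lemma intpart_insert_surj (d n : nat) (d_gt0 : 0 < d) (l : intpart (d + n)) :
  d \in parts l -> exists l', l = intpart_insert d_gt0 l'.
Proof.
move=> d_l; have /and3P[sl l_gt0 /eqP sum_l] := partsP l.
have perm_l := perm_to_rem d_l.
have rem_part : is_intpart n (rem d l).
  apply/and3P; split.
  - apply: subseq_sorted (rem_subseq d l) sl.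
    by move=> x y z /= xy yz; exact: leq_trans yz xy.
  - by move: l_gt0; rewrite (perm_all _ perm_l) => /andP[].
  - by rewrite -(eqn_add2l d) -[eqbRHS]sum_l (perm_sumn perm_l).
exists (IntPart rem_part); apply: intpart_perm_inj.
by rewrite (permPr (intpart_insertP _ _)).
Qed.

(** Inserting [d] raises its multiplicity by one and keeps all parts in [A]. It is injective, and
    any partition containing [d] is reached, so it maps the second set bijectively onto the
    first. *)
Lemma card_partitions_countS (A : set nat) (n d i : nat) :
  0 < d -> d \in A ->
  #|[set l in partitions_in A (d + n) | i < count_mem d (parts l)]|
    = #|[set l in partitions_in A n | i <= count_mem d (parts l)]|.
Proof.
move=> d_gt0 dA; rewrite -(card_imset _ (@intpart_insert_inj d n d_gt0)).
apply: eq_card => l.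
have insertP l' : (intpart_insert d_gt0 l' \in
    [set l in partitions_in A (d + n) | i < count_mem d (parts l)])
    = (l' \in [set l in partitions_in A n | i <= count_mem d (parts l)]).
  have perm_l := intpart_insertP d_gt0 l'.
  by rewrite !inE (perm_all _ perm_l) (permP perm_l) /= dA eqxx add1n ltnS.
apply/idP/imsetP => [l_in|[l' l'_in ->]]; last by rewrite insertP.
have d_l : d \in parts l.
  by move: (l_in); rewrite !inE -has_pred1 has_count => /andP[_]; apply: leq_trans.
have [l' eq_l] := intpart_insert_surj d_gt0 d_l.
by exists l' => //; rewrite -insertP -eq_l.
Qed.

Lemma card_partitions_count (A : set nat) (n d i : nat) : 0 < d -> 0 < i ->
  #|[set l in partitions_in A n | i <= count_mem d (parts l)]|
    = if (d \in A) && (i * d <= n) then npart A (n - i * d) else 0.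
Proof.
(* Since [k] is positive, membership makes [d] a part; a necessary condition [P] for that, once
   false, empties the set. It is used with [d \in A] and with [d <= n]. *)
move=> d_gt0; have empty m k (P : bool) : 0 < k ->
    (forall l : intpart m, d \in parts l -> l \in partitions_in A m -> P) ->
    ~~ P -> #|[set l in partitions_in A m | k <= count_mem d (parts l)]| = 0.
  move=> k_gt0 HP nP; apply: eq_card0 => l; rewrite inE; apply/negP => /andP[lA lk].
  move/negP: nP; apply; apply: (HP l) => //.
  by rewrite -has_pred1 has_count (leq_trans k_gt0).
case: (boolP (d \in A)) => [dA|dnA] i_gt0 /=; last first.
  apply: (empty _ _ (d \in A)) => // l d_l.
  by rewrite finset.in_set => /allP/(_ d d_l).
elim: i n i_gt0 => // i IHi n _.
have [le_dn|lt_nd] := leqP d n; last first.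
  rewrite (empty _ _ (d <= n)) -?ltnNge //; last first.
    move=> l /leq_part_sumn + _.
    by have /and3P[_ _ /eqP->] := partsP l.
  by rewrite leqNgt (leq_trans lt_nd) // mulSn leq_addr.
rewrite -(subnKC le_dn) card_partitions_countS // mulSn leq_add2l subnDl.
(* Deleting the only required copy of [d] leaves the vacuous bound [0 <= count_mem d l], hence all
   of [partitions_in A (n - d)]. *)
case: i IHi => [|i] IHi; last exact: IHi.
rewrite mul0n subn0 leq0n /npart; apply: eq_card => l.
by rewrite !inE andbT.
Qed.

(** * Double counting of the power sums *)

Lemma sum_ltn_leq (n m : nat) : m <= n ->
  \sum_(1 <= i < n.+1) (i <= m : nat) = m.
Proof.
move=> le_mn; rewrite (big_cat_nat (n := m.+1)) //=.
rewrite [X in _ + X]big_nat_cond [X in _ + X]big1 => [|i]; last first.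
  by rewrite andbT => /andP[lt_mi _]; rewrite leqNgt lt_mi.
rewrite addn0 (eq_big_nat _ _ (F2 := fun=> 1)) => [|i /andP[_]].
  by rewrite sum_nat_const_nat subn1 muln1.
by rewrite ltnS => ->.
Qed.

(** Equal parts are grouped, and each multiplicity is written as the number of [i] it bounds. Parts
    and multiplicities are at most [n], so cutting both ranges at [n] loses nothing. *)
Lemma power_sum_count (j n : nat) (l : intpart n) :
  power_sum j l
    = \sum_(1 <= d < n.+1) \sum_(1 <= i < n.+1) d ^ j * (i <= count_mem d l).
Proof.
have /and3P[_ l_gt0 /eqP sum_l] := partsP l.
have le_l : size l <= n by rewrite -[leqRHS]sum_l leq_size_sumn.
transitivity (\sum_(1 <= d < n.+1) d ^ j * count_mem d l); last first.
  apply: eq_bigr => d _; rewrite -big_distrr sum_ltn_leq //.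
  exact: leq_trans (count_size _ _) le_l.
under eq_bigr => d _.
  rewrite -sum1_count big_distrr /= big_mkcond /=.
  over.
rewrite exchange_big /power_sum big_seq [RHS]big_seq; apply: eq_bigr => x x_l.
rewrite (bigD1_seq x) ?iota_uniq //= ?eqxx ?muln1 => [|].
  by rewrite big1 ?addn0 // => d; rewrite eq_sym => /negPf->.
by rewrite mem_index_iota (allP l_gt0) // ltnS -[leqRHS]sum_l leq_part_sumn.
Qed.

(** Only the quotient of [k] by [d] can contribute, and it lies between 1 and [k]. *)
Lemma sum_mul_eq_dvdn (n d k : nat) : 0 < d -> 0 < k <= n ->
  \sum_(1 <= i < n.+1) (i * d == k : nat) = (d %| k).
Proof.
move=> d_gt0 /andP[k_gt0 le_kn]; have [/dvdnP[q def_k]|ndv] := boolP (d %| k).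
  rewrite (bigD1_seq q) ?iota_uniq //= -?def_k ?eqxx.
    by rewrite big1 // => i ne_iq; rewrite def_k eqn_pmul2r // (negPf ne_iq).
  rewrite mem_index_iota ltnS (leq_trans _ le_kn) ?def_k ?leq_pmulr // andbT.
  by move: k_gt0; rewrite def_k muln_gt0 => /andP[].
rewrite big1 // => i _; case: eqP => // def_k.
by rewrite -def_k dvdn_mull in ndv.
Qed.

(** A range of [d] independent of [k] allows the sums over [d] and [k] to be exchanged. *)
Lemma sigma_sum (j : nat) (A : set nat) (n k : nat) : 0 < k <= n ->
  sigma j A k = \sum_(1 <= d < n.+1 | d \in A) d ^ j * (d %| k).
Proof.
move=> /andP[k_gt0 le_kn]; rewrite /sigma.
rewrite [RHS](_ : _ = \sum_(1 <= d < n.+1 | (d \in A) && (d %| k)) d ^ j).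
  rewrite [RHS](eq_bigl (fun d => (d %| k) && (d \in A))) => [|d]; last exact: andbC.
  rewrite -[RHS]big_filter_cond; apply: perm_big; apply: uniq_perm.
  - exact: divisors_uniq.
  - by rewrite filter_uniq ?iota_uniq.
  move=> d; rewrite mem_filter mem_index_iota -dvdn_divisors //.
  case: (boolP (d %| k)) => //= dk.
  by rewrite (dvdn_gt0 k_gt0 dk) ltnS (leq_trans (dvdn_leq k_gt0 dk) le_kn).
rewrite [RHS]big_mkcondr; apply: eq_bigr => d _.
by case: (d %| k); rewrite ?muln1 ?muln0.
Qed.

Lemma sum_power_sum (j : nat) (A : set nat) (n : nat) :
  \sum_(l in partitions_in A n) power_sum j l
    = \sum_(1 <= k < n.+1) sigma j A k * npart A (n - k).
Proof.
(* For positive [d] and [i], this is [npart A (n - i * d)] if [i * d <= n] and 0 otherwise.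
   Truncated subtraction alone would give [npart A 0], not 0, in the second case. The sum also
   introduces the grouping variable [k]. *)
pose F d i := \sum_(1 <= k < n.+1) (i * d == k) * npart A (n - k).
transitivity
  (\sum_(1 <= d < n.+1 | d \in A) \sum_(1 <= i < n.+1) d ^ j * F d i).
  under eq_bigr => l _ do rewrite power_sum_count.
  rewrite exchange_big [RHS]big_mkcond; apply: eq_big_nat => d /andP[d_gt0 _].
  rewrite exchange_big /=.
  transitivity (\sum_(1 <= i < n.+1) if d \in A then d ^ j * F d i else 0);
    last by case: (d \in A) => //; rewrite big1.
  apply: eq_big_nat => i /andP[i_gt0 _].
  rewrite -big_distrr /= -big_mkcondr /= sum1_card.
  transitivity (d ^ j *
      #|[set l in partitions_in A n | i <= count_mem d (parts l)]|).
    by congr muln; apply: eq_card => l; rewrite [in RHS]finset.in_set.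
  rewrite card_partitions_count //; case: (d \in A) => /=; last exact: muln0.
  congr (_ * _); rewrite /F; case: leqP => [le_n|lt_n].
    rewrite (bigD1_seq (i * d)) ?iota_uniq //= ?mem_index_iota ?ltnS ?le_n.
      rewrite eqxx mul1n big1 ?addn0 // => k.
      by rewrite eq_sym => /negPf->.
    by rewrite muln_gt0 i_gt0 d_gt0.
  rewrite big_nat big1 // => k /andP[_ lt_k].
  by rewrite gtn_eqF // (leq_trans lt_k).
(* With [k] moved outermost, the inner sum over [i] merely tests whether [d] divides [k]. *)
under eq_bigr => d _ do
  (rewrite -big_distrr /F exchange_big /= big_distrr /=).
rewrite exchange_big /=; apply: eq_big_nat => k /= k_in.
rewrite (sigma_sum _ _ (n := n)) // big_distrl /=.
rewrite big_nat_cond [RHS]big_nat_cond.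
apply: eq_bigr => d /andP[/andP[d_gt0 _] _].
by rewrite -big_distrl sum_mul_eq_dvdn // mulnA.
Qed.

(** * Summation of Newton's identities over the partitions of [n] *)

Local Open Scope ring_scope.

Lemma sum_power_sum_rat (j : nat) (A : set nat) (n : nat) :
  \sum_(l in partitions_in A n) (power_sum j l)%:R
    = \sum_(1 <= k < n.+1) (sigma j A k)%:R * (npart A (n - k)%N)%:R :> rat.
Proof.
rewrite -natr_sum sum_power_sum natr_sum.
by apply: eq_bigr => k _; rewrite natrM.
Qed.

Lemma sumn_intpart (n : nat) (l : intpart n) : sumn l = n.
Proof. by have /and3P[_ _ /eqP] := partsP l. Qed.

Theorem theorem1 (A : set nat) (hA : forall a : nat, A a -> (0 < a)%N)
    (n : nat) (hn : (0 < n)%N) :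
  ((elem_sym_part 2 A n)%:R : rat) =
    1 / 2%:R * (n%:R ^+ 2 * (npart A n)%:R
      - \sum_(1 <= k < n.+1) (sigma 2 A k)%:R * (npart A (n - k)%N)%:R)
  /\
  ((elem_sym_part 3 A n)%:R : rat) =
    1 / 6%:R * (n%:R ^+ 3 * (npart A n)%:R
      - \sum_(1 <= k < n.+1)
          (3%:R * n%:R * (sigma 2 A k)%:R - 2%:R * (sigma 3 A k)%:R)
          * (npart A (n - k)%N)%:R).
Proof.
split; rewrite /elem_sym_part natr_sum.
  under eq_bigr => l _ do rewrite elem_sym2 sumn_intpart.
  by rewrite -mulr_sumr big_split sumrN /= sum_power_sum_rat sumr_const mulr_natr.
under eq_bigr => l _ do rewrite elem_sym3 sumn_intpart.
rewrite -mulr_sumr !big_split /= sumrN -!mulr_sumr !sum_power_sum_rat.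
rewrite sumr_const -[in LHS]mulr_natr; congr (_ * _); rewrite -addrA; congr (_ + _).
  by rewrite -mulr_natr /npart; ring.
(* Both convolutions run over the same [k] with the same factor [npart A (n - k)], so they merge
   term by term. *)
rewrite !mulr_sumr -sumrN -big_split -sumrN; apply: eq_bigr => k _ /=.
by ring.
Qed.
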